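(* Let $f:\mathbb{R}^n\to\mathbb{R}$ be twice differentiable and bounded below, and suppose that $\|\nabla^2 f(x)-\nabla^2 f(y)\|\le M\|x-y\|$ for all $x,y\in\mathbb{R}^n$, where $M>0$. Let $\{x_k\}$ be the (infinite) sequence generated by the adaptive universal trust-region method in its local regime ($\epsilon=0$), and assume that $x_k\to x^*$ as $k\to+\infty$, where $\nabla f(x^* )=0$ and $\nabla^2 f(x^* )\succeq\mu I$ for some $\mu>0$. Then $\{x_k\}$ converges to $x^*$ quadratically, i.e. there is a constant $C>0$ with $\|x_{k+1}-x^*\|\le C\|x_k-x^*\|^2$ for all sufficiently large $k$.
   Context: Norms are the Euclidean norm for vectors and the induced operator norm for matrices; $\lambda_{\min}$ is the smallest eigenvalue. Subproblem. Given $x_k$, $\sigma\ge0$ and $r>0$: minimize $\tfrac12 d^T(\nabla^2 f(x_k)+\sigma\|\nabla f(x_k)\|^{1/2}I)d+\nabla f(x_k)^Td$ subject to $\|d\|\le r\|\nabla f(x_k)\|^{1/2}$. A solution $d$ comes with a multiplier $\lambda\ge0$ such that $\lambda(\|d\|-r\|\nabla f(x_k)\|^{1/2})=0$, $(\nabla^2 f(x_k)+\sigma\|\nabla f(x_k)\|^{1/2}I+\lambda I)d=-\nabla f(x_k)$, and $\nabla^2 f(x_k)+\sigma\|\nabla f(x_k)\|^{1/2}I+\lambda I\succeq0$. Adaptive universal trust-region method, local regime. For the local analysis the tolerance is taken to be $\epsilon\to0$, so that the branches for $\|\nabla f(x_k)\|<\epsilon$ never apply. Parameters: $x_0$, $0<\eta<\frac1{32}$,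 $\frac14<\xi<1$, initial penalty $\rho_0>0$, minimal penalty $\rho_{\min}>0$, $\gamma_1>1$, $\gamma_2>1$. For $k=0,1,\dots$: set $\rho_k^{(0)}=\rho_k$; for $j=0,1,\dots$: choose $(\sigma_k^{(j)},r_k^{(j)})$ by the strategy below, solve the subproblem (globally) with $\sigma=\sigma_k^{(j)},r=r_k^{(j)}$ to get $(d_k^{(j)},\lambda_k^{(j)})$, and leave the inner loop if the acceptance test below holds; otherwise set $\rho_k^{(j+1)}=\gamma_1\rho_k^{(j)}$. On leaving the inner loop set $x_{k+1}=x_k+d_k^{(j)}$, $\rho_{k+1}=\max\{\rho_{\min},\rho_k^{(j)}/\gamma_2\}$. It is understood that $\nabla f(x_k)\ne0$ for all $k$. Strategy. Write $g=\|\nabla f(x_k)\|$, $\rho=\rho_k^{(j)}$, $\ell=\lambda_{\min}(\nabla^2 f(x_k))$. - If $\ell\le-\rho g^{1/2}$ or $\ell\ge\rho g^{1/2}$: $\sigma_k^{(j)}=0$, $r_k^{(j)}=1/(2\rho)$. - If $-\rho g^{1/2}<\ell<\rho g^{1/2}$: $\sigma_k^{(j)}=\rho$, $r_k^{(j)}=1/(4\rho)$. Acceptance test (with $d=d_k^{(j)}$, $\lambda=\lambda_k^{(j)}$): $f(x_k+d)\le f(x_k)$; [$f(x_k+d)-f(x_k)\le-\frac{\eta}{\rho}g^{3/2}$ or $\|\nabla f(x_k+d)\|\le\xi g$]; and, if $f$ is nonconvex, $\|\nabla f(x_k+d)\|\le\xi g+\lambda\|d\|$, while if $f$ is convex, $\|\nabla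 f(x_k+d)\|\le\frac1\xi g$. *)

(* Defs.v *)
From mathcomp Require Import all_boot all_order all_algebra.
From mathcomp Require Import all_classical all_reals all_analysis.

Set Implicit Arguments.
Unset Strict Implicit.
Unset Printing Implicit Defensive.

Import Order.TTheory GRing.Theory Num.Theory.
Import numFieldNormedType.Exports.

Local Open Scope classical_set_scope.
Local Open Scope ring_scope.

(* Points of R^n are row vectors.  The library norm on 'rV[R]_n is the max norm:
   it is only used through the topology and differentiability it induces, which
   agree with the Euclidean ones.  All norms in formulas are the following. *)

Section LinearAlgebra.
Variables (R : realType) (n : nat).
Implicit Types (u v : 'rV[R]_n) (A : 'M[R]_n).

Definition dot u v : R := \sum_(i < n) u 0 i * v 0 i.

Definition enorm u : R := Num.sqrt (dot u u).

(* A acts on row vectors by v |-> v *m A. *)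
Definition opnorm A : R := sup [set enorm (v *m A) | v in [set v | enorm v <= 1]].

Definition psdmx A : Prop := A^T = A /\ forall v, 0 <= dot (v *m A) v.

(* On a symmetric matrix with n > 0 the set of eigenvalues is finite and
   nonempty, so that this infimum is the smallest eigenvalue. *)
Definition lambda_min A : R := inf [set a | eigenvalue A a].

End LinearAlgebra.

Section Calculus.
Variables (R : realType) (n : nat) (f : 'rV[R]_n -> R).

Definition grad (x : 'rV[R]_n) : 'rV[R]_n := \row_(i < n) 'd f x (delta_mx 0 i).

(* v *m hessian x is the derivative of grad at x in the direction v, hence the
   (i, j) entry is the partial derivative along e_i of the one along e_j. *)
Definition hessian (x : 'rV[R]_n) : 'M[R]_n := 'J grad x.

Definition twice_differentiable : Prop :=
  (forall x, differentiable f x) /\ (forall x, differentiable grad x).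

Definition convex_fun : Prop := convex_function (E := 'rV[R]_n) [set: _] f.

End Calculus.

Section TrustRegion.
Variables (R : realType) (n : nat) (f : 'rV[R]_n -> R).

Definition tr_model (g : 'rV[R]_n) (B : 'M[R]_n) (d : 'rV[R]_n) : R :=
  2^-1 * dot (d *m B) d + dot g d.

Definition tr_solution (x : 'rV[R]_n) (sigma r : R) (d : 'rV[R]_n) (lam : R)
    : Prop :=
  let g := grad f x in
  let B := hessian f x + (sigma * Num.sqrt (enorm g))%:M in
  let radius := r * Num.sqrt (enorm g) in
  [/\ enorm d <= radius,
      forall e, enorm e <= radius -> tr_model g B d <= tr_model g B e
    & [/\ 0 <= lam,
          lam * (enorm d - radius) = 0,
          d *m (B + lam%:M) = - g
        & psdmx (B + lam%:M)]].

(* The pair (sigma, r), given the current penalty. *)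
Definition atr_strategy (x : 'rV[R]_n) (rho : R) : R * R :=
  let t := rho * Num.sqrt (enorm (grad f x)) in
  let l := lambda_min (hessian f x) in
  if (l <= - t) || (t <= l) then (0, 1 / (2 * rho)) else (rho, 1 / (4 * rho)).

Definition atr_accept (eta xi : R) (x : 'rV[R]_n) (rho : R) (d : 'rV[R]_n)
    (lam : R) : Prop :=
  let g := enorm (grad f x) in
  let g' := enorm (grad f (x + d)) in
  [/\ f (x + d) <= f x,
      f (x + d) - f x <= - (eta / rho) * g `^ (3 / 2) \/ g' <= xi * g,
      ~ convex_fun f -> g' <= xi * g + lam * enorm d
    & convex_fun f -> g' <= 1 / xi * g].

(* x is an infinite sequence of iterates of the method with tolerance 0.  At
   outer iteration k the inner iterations are j = 0, ..., J k, the last one being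
   the accepted one; rho k j, d k j and lam k j are irrelevant for j > J k. *)
Definition atr_iterates (eta xi rho0 rhomin gamma1 gamma2 : R)
    (x0 : 'rV[R]_n) (x : nat -> 'rV[R]_n) : Prop :=
  exists (J : nat -> nat) (rho : nat -> nat -> R)
         (d : nat -> nat -> 'rV[R]_n) (lam : nat -> nat -> R),
    [/\ x 0%N = x0, rho 0%N 0%N = rho0
      & forall k,
    [/\ grad f (x k) <> 0,
        forall j, (j <= J k)%N ->
          tr_solution (x k) (atr_strategy (x k) (rho k j)).1
            (atr_strategy (x k) (rho k j)).2 (d k j) (lam k j),
        forall j, (j < J k)%N ->
          ~ atr_accept eta xi (x k) (rho k j) (d k j) (lam k j) /\
          rho k j.+1 = gamma1 * rho k j,
        atr_accept eta xi (x k) (rho k (J k)) (d k (J k)) (lam k (J k))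
      & x k.+1 = x k + d k (J k) /\
        rho k.+1 0%N = Num.max rhomin (rho k (J k) / gamma2)]].

End TrustRegion.

(* Main.v *)
From HB Require Import structures.
Require Import Defs.
From mathcomp Require Import all_boot all_order all_algebra.
From mathcomp Require Import all_classical all_reals all_analysis.
From mathcomp Require Import ring lra.
Import Order.TTheory GRing.Theory Num.Theory.
Import numFieldNormedType.Exports.

Local Open Scope classical_set_scope.
Local Open Scope ring_scope.

(** Write [g] for the gradient norm at the current iterate, [s] for its square
    root, [H] for the Hessian there and [rho] for the penalty.  Near [xs] the
    Hessian satisfies [H >= m] with [m = mu / 2].

    Quadratic convergence is that of Newton's method.  If [2 rho s < m], the
    smallest eigenvalue of [H] exceeds [rho s], so the strategy does not
    regularize; the Newton step has length at most [g / m], less than the radius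
    [s / (2 rho)], so the multiplier vanishes and the step taken is the Newton
    step.  It is accepted at once when [g] is small
    ([newton_step_accepted]), and it contracts the error quadratically
    ([newton_step_quadratic]).

    It remains to see that [rho s] does become small, although the penalty might
    grow.  It cannot: a penalty above a threshold fixed by [M] and [xi] is always
    accepted at the first trial ([large_penalty_accepted]), so the next outer
    iteration starts from a penalty that is not larger (unless it is [rhomin]).
    If [rho s] stayed away from 0, then, since [s] tends to 0, the penalties
    would eventually exceed the threshold, hence be bounded, and [rho s] would
    tend to 0 after all.  And once [rho s] is small it remains so, because Newton
    steps are accepted at the first trial and do not increase [s]
    ([penalty_times_root_gradient_small]).

    Two tools serve these estimates.  Second-order Taylor bounds for [f] and its
    gradient ([potential_taylor], [jacobian_taylor]) come from the mean value
    theorem along a segment; a cruder constant [M] in place of [M / 2] and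
    [M / 6] is harmless, since the constants are absorbed by the threshold on
    [rho] or by the smallness of [g].  The Rayleigh bounds for the smallest
    eigenvalue ([lambda_min_le], [lambda_min_ge]) come from minimizing the
    quadratic form over the unit sphere. *)

(** * Euclidean geometry of row vectors *)

Section Euclid.
Context {R : realType} {n : nat}.
Implicit Types (u v w : 'rV[R]_n) (A : 'M[R]_n) (a c : R).

Lemma dotE u v : dot u v = (u *m v^T) 0 0.
Proof. by rewrite mxE; apply: eq_bigr => i _; rewrite mxE. Qed.

Lemma dotC u v : dot u v = dot v u.
Proof. by apply: eq_bigr => i _; rewrite mulrC. Qed.

Lemma dotDl u v w : dot (u + v) w = dot u w + dot v w.
Proof. by rewrite !dotE mulmxDl mxE. Qed.

Lemma dotZl a u w : dot (a *: u) w = a * dot u w.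
Proof. by rewrite !dotE -scalemxAl mxE. Qed.

Lemma dotNl u w : dot (- u) w = - dot u w.
Proof. by rewrite !dotE mulNmx mxE. Qed.

Lemma dotBl u v w : dot (u - v) w = dot u w - dot v w.
Proof. by rewrite dotDl dotNl. Qed.

Lemma dotDr u v w : dot w (u + v) = dot w u + dot w v.
Proof. by rewrite dotC dotDl !(dotC w). Qed.

Lemma dotZr a u w : dot w (a *: u) = a * dot w u.
Proof. by rewrite dotC dotZl (dotC w). Qed.

Lemma dotNr u w : dot w (- u) = - dot w u.
Proof. by rewrite dotC dotNl (dotC w). Qed.

Lemma dot0l v : dot 0 v = 0.
Proof. by rewrite -(scale0r 0) dotZl mul0r. Qed.

Lemma dot_mulmx_sym A u v : A^T = A -> dot (u *m A) v = dot (v *m A) u.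
Proof. by move=> AT; rewrite dotE dotC dotE trmx_mul AT mulmxA. Qed.

Lemma dot_ge0 u : 0 <= dot u u.
Proof. by apply: sumr_ge0 => i _; rewrite -expr2 sqr_ge0. Qed.

Lemma dot_eq0 u : (dot u u == 0) = (u == 0).
Proof.
apply/eqP/eqP => [u0|->]; last exact: dot0l.
apply/rowP => i; rewrite mxE; apply/eqP; rewrite -sqrf_eq0 expr2; apply/eqP.
by apply: (psumr_eq0P _ u0) => // j _; rewrite -expr2 sqr_ge0.
Qed.

Lemma enorm_ge0 u : 0 <= enorm u.
Proof. exact: sqrtr_ge0. Qed.

Lemma enorm_sqr u : enorm u ^+ 2 = dot u u.
Proof. by rewrite sqr_sqrtr// dot_ge0. Qed.

Lemma enorm_eq0 u : (enorm u == 0) = (u == 0).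
Proof. by rewrite -dot_eq0 -enorm_sqr sqrf_eq0. Qed.

Lemma enorm0 : enorm (0 : 'rV[R]_n) = 0.
Proof. by apply/eqP; rewrite enorm_eq0. Qed.

Lemma enormN u : enorm (- u) = enorm u.
Proof. by rewrite /enorm dotNl dotNr opprK. Qed.

Lemma enormZ a u : enorm (a *: u) = `|a| * enorm u.
Proof.
by rewrite /enorm dotZl dotZr mulrA -expr2 sqrtrM ?sqr_ge0// sqrtr_sqr.
Qed.

(** The nonnegative quadratic form is evaluated at the combinations of [v] and [w]
    that make it the defect [p * s - b ^+ 2] times [s] or [p]; when both [p] and
    [s] vanish, [v - b *: w] shows that [b] does too. *)
Lemma psd_cauchy_schwarz A v w : psdmx A ->
  dot (v *m A) w ^+ 2 <= dot (v *m A) v * dot (w *m A) w.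
Proof.
case=> AT A0; set b := dot (v *m A) w.
have q a c : 0 <= a ^+ 2 * dot (v *m A) v + 2 * a * c * b
                  + c ^+ 2 * dot (w *m A) w.
  have := A0 (a *: v + c *: w); rewrite mulmxDl -!scalemxAl.
  rewrite !(dotDl, dotDr, dotZl, dotZr) (dot_mulmx_sym _ w v)// -/b.
  by congr (_ <= _); ring.
have [p0 s0] := (A0 v, A0 w).
have := q (dot (w *m A) w) (- b); have := q (- b) (dot (v *m A) v).
have := q 1 (- b); move: p0 s0.
set p := dot (v *m A) v; set s := dot (w *m A) w => p0 s0 q1 q2 q3.
have [p_gt0|p_le0] := ltP 0 p; first by rewrite -(ler_pM2l p_gt0); nra.
have [s_gt0|s_le0] := ltP 0 s; first by rewrite -(ler_pM2l s_gt0); nra.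
have -> : p = 0 by lra.
have s_eq0 : s = 0 by lra.
by rewrite s_eq0 in q1 *; nra.
Qed.

Lemma psdmx1 : psdmx (1%:M : 'M[R]_n).
Proof. by split=> [|v]; rewrite ?trmx1// mulmx1 dot_ge0. Qed.

Lemma cauchy_schwarz u v : dot u v <= enorm u * enorm v.
Proof.
have := psd_cauchy_schwarz _ u v psdmx1; rewrite !mulmx1 => uv.
rewrite (le_trans (ler_norm _))// -ler_sqr ?nnegrE ?mulr_ge0 ?enorm_ge0//.
by rewrite exprMn !enorm_sqr real_normK ?num_real.
Qed.

Lemma enormD u v : enorm (u + v) <= enorm u + enorm v.
Proof.
rewrite -ler_sqr ?nnegrE ?addr_ge0 ?enorm_ge0// sqrrD !enorm_sqr.
rewrite !(dotDl, dotDr) (dotC v u); have := cauchy_schwarz u v; lra.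
Qed.

(** This makes the supremum that defines [opnorm] a genuine one; by Cauchy-Schwarz
    on each coordinate the Frobenius norm of [A] is a bound. *)
Lemma enorm_mulmx_bound A : exists K, forall v, enorm (v *m A) <= K * enorm v.
Proof.
exists (Num.sqrt (\sum_j dot (row j A^T) (row j A^T))) => v.
rewrite /enorm -sqrtrM ?sumr_ge0// => [|j _]; last exact: dot_ge0.
rewrite ler_wsqrtr// mulr_suml; apply: ler_sum => j _.
have -> : (v *m A) 0 j = dot v (row j A^T).
  by rewrite mxE; apply: eq_bigr => i _; rewrite !mxE.
have := psd_cauchy_schwarz _ v (row j A^T) psdmx1.
by rewrite !mulmx1 -expr2 mulrC.
Qed.

Lemma enorm_mulmx A v : enorm (v *m A) <= opnorm A * enorm v.
Proof.
have [K KP] := enorm_mulmx_bound A.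
have [->|v0] := eqVneq v 0; first by rewrite mul0mx enorm0 mulr0.
have v_gt0 : 0 < enorm v by rewrite lt0r enorm_eq0 v0 enorm_ge0.
rewrite -ler_pdivrMr// mulrC.
have -> : (enorm v)^-1 * enorm (v *m A) = enorm ((enorm v)^-1 *: v *m A).
  by rewrite -scalemxAl enormZ gtr0_norm ?invr_gt0.
apply: ub_le_sup.
  exists `|K| => _ [w /= w1 <-]; apply: (le_trans (KP w)).
  apply: le_trans (ler_norm _) _; rewrite normrM (ger0_norm (enorm_ge0 w)).
  by rewrite ler_piMr.
exists ((enorm v)^-1 *: v) => //=.
by rewrite enormZ gtr0_norm ?invr_gt0// mulVf// lt0r_neq0.
Qed.

Lemma dot_continuous (T : topologicalType) (g h : T -> 'rV[R]_n) :
  (forall i, continuous (fun t => g t 0 i)) ->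
  (forall i, continuous (fun t => h t 0 i)) ->
  continuous (fun t => dot (g t) (h t)).
Proof.
move=> gc hc; rewrite /dot.
have addc : continuous (fun z : R * R => z.1 + z.2) by exact: add_continuous.
apply: (@continuous_big _ _ _ _ _ addc) => i _ t.
by apply: cvgM; [exact: gc|exact: hc].
Qed.

Lemma enorm_continuous : continuous (@enorm R n).
Proof.
move=> u; apply: (@continuous_comp _ _ _ (fun v : 'rV[R]_n => dot v v)).
  by apply: dot_continuous => i; exact: coord_continuous.
exact: sqrt_continuous.
Qed.

Lemma quadform_continuous A : continuous (fun v : 'rV[R]_n => dot (v *m A) v).
Proof.
apply: dot_continuous => i; last exact: coord_continuous.
have -> : (fun v : 'rV[R]_n => (v *m A) 0 i) = fun v => dot v (row i A^T).
  apply/funext => v.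
  by rewrite !mxE; apply: eq_bigr => j _; rewrite !mxE.
apply: dot_continuous => j; first exact: coord_continuous.
exact: cst_continuous.
Qed.

(** A minimizer [v] of the quadratic form of [A] on the unit sphere, with value
    [a], is an eigenvector: [A - a%:M] is positive semidefinite and its form
    vanishes at [v], so Cauchy-Schwarz for that form gives [v *m (A - a%:M) = 0].
    The vector [u] excludes dimension 0, where there is no eigenvalue. *)
Lemma rayleigh_min A u : A^T = A -> u != 0 ->
  exists2 a, eigenvalue A a & forall v, a * dot v v <= dot (v *m A) v.
Proof.
move=> AT u0.
pose S := [set v : 'rV[R]_n | dot v v = 1].
have uS v : dot v v != 0 -> S ((enorm v)^-1 *: v).
  move=> v0; rewrite /S/= dotZl dotZr -enorm_sqr; field.
  by rewrite enorm_eq0 -dot_eq0.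
have compS : compact S.
  apply: bounded_closed_compact.
    exists 1; split=> // b b1 v /= v1; apply: le_trans (ltW b1).
    rewrite [leLHS]mx_normrE; apply/bigmax_leP; split=> // -[i j] _ /=.
    rewrite (ord1 i) -ler_sqr ?nnegrE// expr1n real_normK ?num_real// -v1.
    rewrite /dot (bigD1 j)//= -expr2 lerDl sumr_ge0// => k _.
    by rewrite -expr2 sqr_ge0.
  have -> : S = (fun v : 'rV[R]_n => dot v v) @^-1` [set 1] by [].
  apply: preimage_closed => [v _|]; last exact: closed_eq.
  by apply: dot_continuous => i; exact: coord_continuous.
have u0' : dot u u != 0 by rewrite dot_eq0.
have [v vS vmin] := @compact_EVT_min _ R (fun v => dot (v *m A) v) S
  (ex_intro _ _ (uS u u0')) compS
  (continuous_subspaceT (quadform_continuous A)).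
rewrite inE/= in vS.
pose a := dot (v *m A) v.
have psdB : psdmx (A - a%:M).
  split=> [|w]; first by rewrite linearB/= AT tr_scalar_mx.
  rewrite mulmxBr mul_mx_scalar dotBl dotZl subr_ge0.
  have [->|w0] := eqVneq w 0; first by rewrite mul0mx !dot0l mulr0.
  have w_gt0 : 0 < dot w w by rewrite lt0r dot_eq0 w0 dot_ge0.
  have := vmin ((enorm w)^-1 *: w); rewrite inE.
  move=> /(_ (uS _ (lt0r_neq0 w_gt0))).
  rewrite -scalemxAl dotZl dotZr mulrA -invfM -expr2 enorm_sqr -/a.
  by rewrite ler_pdivlMl// mulrC.
exists a.
  apply/eigenvalueP; exists v; last first.
    by rewrite -dot_eq0 vS oner_eq0.
  apply/eqP; rewrite -subr_eq0 -mul_mx_scalar -mulmxBr -dot_eq0.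
  rewrite -sqrf_eq0 eq_le sqr_ge0 andbT.
  have q0 : dot (v *m (A - a%:M)) v = 0.
    by rewrite mulmxBr mul_mx_scalar dotBl dotZl vS mulr1 subrr.
  by have := psd_cauchy_schwarz _ v (v *m (A - a%:M)) psdB; rewrite q0 mul0r.
move=> w; have [_ /(_ w)] := psdB.
by rewrite mulmxBr mul_mx_scalar dotBl dotZl subr_ge0.
Qed.

Lemma lambda_min_le A v : A^T = A -> lambda_min A * dot v v <= dot (v *m A) v.
Proof.
move=> AT; have [->|v0] := eqVneq v 0; first by rewrite mul0mx !dot0l mulr0.
have [a aA aP] := rayleigh_min _ _ AT v0.
apply: le_trans (aP v); rewrite ler_wpM2r ?dot_ge0//.
apply: ge_inf => //; exists a => b /= /eigenvalueP[w wA w0].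
have := aP w; rewrite wA dotZl ler_pM2r// lt0r dot_eq0 w0 dot_ge0//.
Qed.

Lemma lambda_min_ge A c u : A^T = A -> u != 0 ->
  (forall v, c * dot v v <= dot (v *m A) v) -> c <= lambda_min A.
Proof.
move=> AT u0 cA; have [a aA _] := rayleigh_min _ _ AT u0.
apply: lb_le_inf; first by exists a.
move=> b /= /eigenvalueP[w wA w0].
by have := cA w; rewrite wA dotZl ler_pM2r// lt0r dot_eq0 w0 dot_ge0.
Qed.

End Euclid.

(** * Taylor estimates *)

Section Taylor.
Context {R : realType} {n : nat}.
Implicit Types (u v w x d : 'rV[R]_n).

Lemma is_derive_line (W : normedModType R) (F : 'rV[R]_n -> W) x d (t : R) :
  differentiable F (x + t *: d) ->
  is_derive t 1 (fun s : R => F (x + s *: d)) ('d F (x + t *: d) d).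
Proof.
move=> dF; pose h (s : R) := x + s *: d.
have dh : is_diff t h (fun s => s *: d).
  apply: is_diff_eq.
  by rewrite funeqE => s /=; rewrite add0r.
have dFh : differentiable (F \o h) t by exact: differentiable_comp.
split; first exact/derivable1_diffP.
by rewrite deriveE// diff_comp//= diff_val scale1r.
Qed.

Lemma diff_dot_grad (f : 'rV[R]_n -> R) x d : 'd f x d = dot (grad f x) d.
Proof.
rewrite {1}[d]row_sum_delta linear_sum /dot; apply: eq_bigr => i _.
by rewrite linearZ/= /grad mxE mulrC.
Qed.

Lemma is_derive_dot_line (F : 'rV[R]_n -> 'rV[R]_n) u x d (t : R) :
  differentiable F (x + t *: d) ->
  is_derive t 1 (fun s : R => dot (F (x + s *: d)) u)
    (dot (d *m 'J F (x + t *: d)) u).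
Proof.
move=> dF.
have lin : linear (fun v : 'rV[R]_n => dot v u : R^o).
  by move=> a v w; rewrite dotDl dotZl.
pose L : {linear 'rV[R]_n -> R^o} :=
  HB.pack (fun v : 'rV[R]_n => dot v u : R^o)
    (GRing.isLinear.Build _ _ _ _ _ lin).
have Lc : continuous L.
  apply: dot_continuous => i; first exact: coord_continuous.
  exact: cst_continuous.
have -> : dot (d *m 'J F (x + t *: d)) u = 'd (L \o F) (x + t *: d) d.
  rewrite diff_comp//; last exact: linear_differentiable.
  by rewrite diff_lin//= mul_rV_lin1.
apply: (is_derive_line _ (L \o F)).
by apply: differentiable_comp => //; exact: linear_differentiable.
Qed.

(** The mean value inequality on the unit interval, one-sided so that it applies
    both to scalar products and to values of a function. *)
Lemma mvt01 (phi dphi : R -> R) (K : R) :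
  (forall t : R, is_derive t 1 phi (dphi t)) ->
  (forall t, 0 <= t <= 1 -> dphi t <= K) -> phi 1 - phi 0 <= K.
Proof.
move=> der bnd.
have phi_cont : {within `[0, 1], continuous phi}.
  apply: continuous_subspaceT => t; apply: differentiable_continuous.
  by apply/derivable1_diffP; have [] := der t.
have [c c01 ->] := MVT ltr01 (fun t _ => der t) phi_cont.
rewrite subr0 mulr1 bnd//.
by move: c01; rewrite in_itv/= => /andP[c0 c1]; rewrite !ltW.
Qed.

Lemma is_derive_mulr_const (t c : R) : is_derive t 1 (fun s : R => s * c) c.
Proof.
have -> : (fun s : R => s * c) = c \*: id.
  by apply/funext => s /=; rewrite /GRing.scale/= mulrC.
by apply: is_derive_eq; rewrite /GRing.scale/= mulr1.
Qed.

Lemma is_derive_sqr_const (t c : R) :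
  is_derive t 1 (fun s : R => s ^+ 2 * (2^-1 * c)) (t * c).
Proof.
have -> : (fun s : R => s ^+ 2 * (2^-1 * c)) = (2^-1 * c) \*: (id ^+ 2).
  by apply/funext => s /=; rewrite /GRing.scale/= mulrC.
by apply: is_derive_eq; rewrite /GRing.scale/=; field.
Qed.

Section JacobianLipschitz.
Context (G : 'rV[R]_n -> 'rV[R]_n) (M : R).
Hypothesis dG : forall x, differentiable G x.
Hypothesis M_ge0 : 0 <= M.
Hypothesis jac_lip : forall y z : 'rV[R]_n,
  opnorm ('J G y - 'J G z) <= M * enorm (y - z).

(** The mean value inequality is applied to the component of the remainder along
    the remainder [e] itself, which turns a vector estimate into a scalar one. *)
Lemma jacobian_taylor x d :
  enorm (G (x + d) - G x - d *m 'J G x) <= M * enorm d ^+ 2.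
Proof.
have [e e_def] : exists e : 'rV[R]_n, e = G (x + d) - G x - d *m 'J G x.
  by eexists.
rewrite -e_def.
have [->|e0] := eqVneq e 0.
  by rewrite enorm0 mulr_ge0// sqr_ge0.
have e_gt0 : 0 < enorm e by rewrite lt0r enorm_eq0 e0 enorm_ge0.
rewrite -(ler_pM2r e_gt0) -[leLHS]expr2 (enorm_sqr e).
pose phi (t : R) := dot (G (x + t *: d)) e - t * dot (d *m 'J G x) e.
have -> : dot e e = phi 1 - phi 0.
  rewrite /phi (scale1r d) (scale0r d) addr0.
  by rewrite {1}e_def 2!dotBl; ring.
apply: (mvt01 _ (fun t => dot (d *m ('J G (x + t *: d) - 'J G x)) e)).
  move=> t; rewrite mulmxBr dotBl.
  have D1 := is_derive_dot_line _ e _ d t (dG (x + t *: d)).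
  exact: (is_deriveB D1 (is_derive_mulr_const _ _)).
move=> t /andP[t0 t1].
apply: le_trans (cauchy_schwarz _ _) _; rewrite ler_wpM2r ?enorm_ge0//.
apply: le_trans (enorm_mulmx _ _) _.
have := jac_lip (x + t *: d) x.
rewrite [X in M * enorm X]addrC addKr enormZ ger0_norm// => h.
apply: le_trans (ler_wpM2r (enorm_ge0 d) h) _.
by rewrite expr2 !mulrA !ler_wpM2r ?enorm_ge0// ler_piMr.
Qed.

(** Along the segment the derivative of the remainder of [f] is the remainder of
    its gradient field [G] paired with [d]. *)
Lemma potential_taylor (f : 'rV[R]_n -> R) x d :
  (forall y, differentiable f y) -> (forall y v, 'd f y v = dot (G y) v) ->
  f (x + d) - f x <=
    dot (G x) d + 2^-1 * dot (d *m 'J G x) d + M * enorm d ^+ 3.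
Proof.
move=> df dfG; pose g := dot (G x) d; pose q := dot (d *m 'J G x) d.
pose phi (t : R) := f (x + t *: d) - (t * g + t ^+ 2 * (2^-1 * q)).
suff : phi 1 - phi 0 <= M * enorm d ^+ 3.
  by rewrite /phi (scale1r d) (scale0r d) addr0 -/g -/q; lra.
apply: (mvt01 _ (fun t =>
    dot (G (x + t *: d) - G x - (t *: d) *m 'J G x) d)).
  move=> t; rewrite 2!dotBl -scalemxAl dotZl -dfG -/g -/q.
  rewrite -addrA -opprD.
  have D1 := is_derive_line _ _ _ d t (df (x + t *: d)).
  apply: (is_deriveB D1).
  exact: (is_deriveD (is_derive_mulr_const t g) (is_derive_sqr_const t q)).
move=> t /andP[t0 t1].
apply: le_trans (cauchy_schwarz _ _) _.
apply: le_trans (ler_wpM2r (enorm_ge0 d) (jacobian_taylor _ _)) _.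
rewrite enormZ ger0_norm// exprMn [_ ^+ 3]exprSr !mulrA.
by rewrite !ler_wpM2r ?enorm_ge0// -mulrA ler_piMr// mulr_ile1.
Qed.

End JacobianLipschitz.

End Taylor.

(** * Steps solving a shifted Newton equation *)

Section Step.
Context {R : realType} {n : nat} (f : 'rV[R]_n -> R) (M : R).
Hypothesis f2 : twice_differentiable f.
Hypothesis M_ge0 : 0 <= M.
Hypothesis hess_lip : forall y z : 'rV[R]_n,
  opnorm (hessian f y - hessian f z) <= M * enorm (y - z).
Implicit Types (x d g v : 'rV[R]_n) (H : 'M[R]_n).

(** Pair the equation of the step with [d].  Used with [m = 0] it also bounds
    [tau * enorm d], and with [tau = 0] it inverts [H]. *)
Lemma shifted_step_bound g H d m tau :
  d *m H + tau *: d = - g -> (forall v, m * dot v v <= dot (v *m H) v) ->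
  (m + tau) * enorm d <= enorm g.
Proof.
move=> dH Hm; have [->|d0] := eqVneq d 0.
  by rewrite enorm0 mulr0 enorm_ge0.
have d_gt0 : 0 < enorm d by rewrite lt0r enorm_eq0 d0 enorm_ge0.
rewrite -(ler_pM2r d_gt0); apply: le_trans (_ : dot (- g) d <= _).
  rewrite -dH dotDl dotZl -mulrA -expr2 enorm_sqr mulrDl lerD2r; exact: Hm.
by rewrite -(enormN g) cauchy_schwarz.
Qed.

Lemma shifted_step_grad x d tau : d *m hessian f x + tau *: d = - grad f x ->
  0 <= tau -> enorm (grad f (x + d)) <= M * enorm d ^+ 2 + tau * enorm d.
Proof.
move=> dH tau0; have := jacobian_taylor _ _ f2.2 M_ge0 hess_lip x d.
rewrite -/(hessian f x); move: (grad f (x + d)) (grad f x) dH => g' g dH.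
have -> : g' - g - d *m hessian f x = g' + tau *: d.
  by rewrite -(opprK g) -dH opprK addrA addrAC addrK.
rewrite -{2}(ger0_norm tau0) -enormZ => h.
have := enormD (g' + tau *: d) (- (tau *: d)); rewrite addrK enormN; lra.
Qed.

Lemma shifted_step_decrease x d tau :
  d *m hessian f x + tau *: d = - grad f x ->
  f (x + d) - f x <=
    - (2^-1 * dot (d *m hessian f x) d) - tau * enorm d ^+ 2 + M * enorm d ^+ 3.
Proof.
move=> dH.
apply: le_trans
  (potential_taylor _ _ f2.2 M_ge0 hess_lip f x d f2.1 (diff_dot_grad f)) _.
rewrite -/(hessian f x); move: (grad f x) dH => g dH.
have -> : dot g d = - dot (d *m hessian f x) d - tau * enorm d ^+ 2.
  by rewrite -(opprK g) -dH dotNl dotDl dotZl enorm_sqr opprD.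
lra.
Qed.

End Step.

(** * Scalar estimates behind the acceptance test *)

Section ScalarEstimates.
Context {R : realFieldType}.
Implicit Types (m M eta xi rho lam tau D Q s g delta : R).

(** A positive multiplier would put the step on the boundary of the trust region,
    which lies outside the ball of radius [g / m] containing the step. *)
Lemma small_radius_multiplier m rho lam s g D :
  0 < m -> 0 < rho -> 0 < s -> s ^+ 2 = g -> 0 <= lam ->
  lam * (D - 1 / (2 * rho) * s) = 0 -> (m + lam) * D <= g ->
  2 * (rho * s) < m -> lam = 0.
Proof.
move=> m0 rho0 s0 <- lam0 compl d_le rho_s.
apply/eqP; move/eqP: compl; rewrite mulf_eq0 => /orP[//|].
rewrite subr_eq0 => /eqP dE; exfalso.
have dE' : s = 2 * rho * D by rewrite dE; field; rewrite gt_eqF.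
have : (m + lam) * s <= 2 * rho * s * s by rewrite {1}dE'; nra.
by rewrite ler_pM2r//; lra.
Qed.

Lemma inv_xi_ge xi : 1 / 4 < xi -> 2 - xi <= 1 / xi.
Proof.
move=> xi0; have xi_gt0 : 0 < xi by lra.
by rewrite ler_pdivlMr//; have := sqr_ge0 (1 - xi); rewrite expr2; lra.
Qed.

Lemma newton_estimates xi m M D Q g (g' : R) delta :
  1 / 4 < xi < 1 -> 0 < m -> 0 <= M -> 0 <= D -> 0 <= g ->
  m * D <= g -> 4 * M * g <= m ^+ 2 ->
  m * D ^+ 2 <= Q -> delta <= - (2^-1 * Q) + M * D ^+ 3 -> g' <= M * D ^+ 2 ->
  [/\ delta <= 0, g' <= xi * g, g' <= 1 / xi * g & g' <= g].
Proof.
move=> /andP[xi0 xi1] m0 M0 D0 g0 mD Mg Q_ge dec grad_le.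
have MD : M * D <= m / 4 by rewrite -(ler_pM2l m0); nra.
have MD2 : M * D ^+ 2 <= g / 4.
  by have /= := ler_wpM2r D0 MD; rewrite expr2; lra.
have xi' := ler_wpM2r g0 (inv_xi_ge _ xi0); rewrite /= in xi'.
have xig : 1 / 4 * g <= xi * g by rewrite ler_wpM2r// ltW.
have xig' : xi * g <= 1 * g by rewrite ler_wpM2r// ltW.
split; [|by lra|by lra|by lra].
apply: le_trans dec _; rewrite [_ ^+ 3]exprS mulrA.
have := sqr_ge0 D; nra.
Qed.

Lemma scaled_radius c rho D s : 0 < c -> 0 < rho ->
  D <= 1 / (c * rho) * s -> rho * D <= s / c.
Proof.
move=> c0 rho0 D_le; apply: le_trans (ler_wpM2l (ltW rho0) D_le) _.
rewrite le_eqVlt; apply/orP; left; apply/eqP; field.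
by rewrite !gt_eqF.
Qed.

(** The Lipschitz constant [M] enters the acceptance test only through
    [M / rho ^+ 2], as lengths of steps are measured in units of [1 / rho]. *)
Lemma scaled_remainder M K rho D p :
  0 <= K -> 0 < rho -> 0 <= D -> rho * D <= p -> M <= K * rho ^+ 2 ->
  M * D ^+ 2 <= K * p ^+ 2.
Proof.
move=> K0 rho0 D0 rDp MK; have rD0 : 0 <= rho * D by rewrite mulr_ge0// ltW.
apply: le_trans (_ : K * (rho * D) ^+ 2 <= _).
  by rewrite exprMn (mulrA K) ler_wpM2r// sqr_ge0.
by rewrite ler_wpM2l// lerXn2r ?nnegrE// (le_trans _ rDp).
Qed.

Lemma scaled_cubic_remainder M K rho D p :
  0 <= K -> 0 < rho -> 0 <= D -> rho * D <= p -> M <= K * rho ^+ 2 ->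
  M * D ^+ 3 <= K * (rho * D ^+ 2) * p.
Proof.
move=> K0 rho0 D0 rDp MK.
apply: le_trans (ler_wpM2r (exprn_ge0 3 D0) MK) _.
have -> : K * rho ^+ 2 * D ^+ 3 = K * (rho * D ^+ 2) * (rho * D) by ring.
by rewrite ler_wpM2l// mulr_ge0// mulr_ge0 ?sqr_ge0// ltW.
Qed.

Section LargePenalty.
Variables (M eta xi rho lam D Q s g g' delta : R).
Hypotheses (eta_range : 0 < eta < 1 / 32) (xi_range : 1 / 4 < xi < 1).
Hypotheses (rho_gt0 : 0 < rho) (s_gt0 : 0 < s) (gE : s ^+ 2 = g).
Hypotheses (M_le1 : M <= (xi - 1 / 4) * rho ^+ 2).
Hypotheses (M_le2 : M <= (1 - xi) * rho ^+ 2).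
Hypotheses (D_ge0 : 0 <= D) (lam_ge0 : 0 <= lam).

(** [delta] is the change of [f], [g'] the gradient norm after the step. *)
Let acceptance := [/\ delta <= 0,
  delta <= - (eta / rho) * s ^+ 3 \/ g' <= xi * g,
  g' <= xi * g + lam * D & g' <= 1 / xi * g].

Lemma sufficient_decrease a : eta <= a -> delta <= - a * (s ^+ 3 / rho) ->
  delta <= - (eta / rho) * s ^+ 3.
Proof.
move=> eta_a; move/le_trans; apply.
have -> : - (eta / rho) * s ^+ 3 = - eta * (s ^+ 3 / rho).
  by field; rewrite gt_eqF.
by rewrite ler_wpM2r ?lerN2// divr_ge0 ?exprn_ge0 ?ltW.
Qed.

(** Here the curvature of the Hessian itself, at least [rho * s], provides the
    decrease.  If the multiplier vanishes the gradient after the step is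
    quadratically small; otherwise the step has the full length
    [s / (2 * rho)] and the decrease is of order [s ^+ 3 / rho]. *)
Lemma unregularized_estimates :
  D <= 1 / (2 * rho) * s -> lam * (D - 1 / (2 * rho) * s) = 0 ->
  rho * s * D ^+ 2 <= Q -> lam * D <= g ->
  delta <= - (2^-1 * Q) - lam * D ^+ 2 + M * D ^+ 3 ->
  g' <= M * D ^+ 2 + lam * D -> acceptance.
Proof.
have /andP[xi0 xi1] := xi_range; have /andP[eta0 eta1] := eta_range.
have [K1 K2] : 0 <= xi - 1 / 4 /\ 0 <= 1 - xi by split; lra.
move=> D_le compl Q_ge lamD dec grad_le.
have rD := scaled_radius _ _ _ _ (ltr0n R 2) rho_gt0 D_le.
have MD1 := scaled_remainder _ _ _ _ _ K1 rho_gt0 D_ge0 rD M_le1.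
have MD2 := scaled_remainder _ _ _ _ _ K2 rho_gt0 D_ge0 rD M_le2.
have MD3 := scaled_cubic_remainder _ _ _ _ _ K2 rho_gt0 D_ge0 rD M_le2.
rewrite expr_div_n in MD1 MD2.
have s2 : 0 < s ^+ 2 by rewrite exprn_gt0.
have rsD0 : 0 <= rho * s * D ^+ 2 by rewrite mulr_ge0 ?sqr_ge0// mulr_ge0 ?ltW.
have xirsD0 : 0 <= xi * (rho * s * D ^+ 2) by rewrite mulr_ge0//; lra.
have lamD2 : 0 <= lam * D ^+ 2 by rewrite mulr_ge0 ?sqr_ge0.
have lamD0 : 0 <= lam * D by rewrite mulr_ge0.
have xis2 : 0 <= (1 - xi) * s ^+ 2 by rewrite mulr_ge0// ltW.
have xis2' : 0 <= (xi - 1 / 4) * s ^+ 2 by rewrite mulr_ge0// ltW.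
have inv_le : (2 - xi) * s ^+ 2 <= 1 / xi * s ^+ 2.
  by rewrite ler_wpM2r ?inv_xi_ge// ltW.
rewrite /acceptance -gE in lamD *.
split; [by lra| |by lra|by lra].
move/eqP: compl; rewrite mulf_eq0 => /orP[/eqP lam_eq0|].
  by right; rewrite lam_eq0 in grad_le; lra.
rewrite subr_eq0 => /eqP DE; left.
apply: (sufficient_decrease (xi / 8)); first by lra.
have -> : - (xi / 8) * (s ^+ 3 / rho) = - xi / 2 * (rho * s * D ^+ 2).
  by rewrite DE; field; rewrite gt_eqF.
by lra.
Qed.

(** Here the added term [rho * s] provides the decrease.  If the multiplier
    vanishes the gradient after the step is essentially [rho * s * D <= g / 4],
    which is where [xi > 1 / 4] is needed. *)
Lemma regularized_estimates :
  D <= 1 / (4 * rho) * s -> lam * (D - 1 / (4 * rho) * s) = 0 ->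
  0 <= Q -> (rho * s + lam) * D <= g ->
  delta <= - (2^-1 * Q) - (rho * s + lam) * D ^+ 2 + M * D ^+ 3 ->
  g' <= M * D ^+ 2 + (rho * s + lam) * D -> acceptance.
Proof.
have /andP[xi0 xi1] := xi_range; have /andP[eta0 eta1] := eta_range.
have [K1 K2] : 0 <= xi - 1 / 4 /\ 0 <= 1 - xi by split; lra.
move=> D_le compl Q_ge tauD dec grad_le.
have rD := scaled_radius _ _ _ _ (ltr0n R 4) rho_gt0 D_le.
have MD1 := scaled_remainder _ _ _ _ _ K1 rho_gt0 D_ge0 rD M_le1.
have MD2 := scaled_remainder _ _ _ _ _ K2 rho_gt0 D_ge0 rD M_le2.
have MD3 := scaled_cubic_remainder _ _ _ _ _ K2 rho_gt0 D_ge0 rD M_le2.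
rewrite expr_div_n in MD1 MD2.
have s2 : 0 < s ^+ 2 by rewrite exprn_gt0.
have rsD0 : 0 <= rho * s * D ^+ 2 by rewrite mulr_ge0 ?sqr_ge0// mulr_ge0 ?ltW.
have xirsD0 : 0 <= xi * (rho * s * D ^+ 2) by rewrite mulr_ge0//; lra.
have lamD2 : 0 <= lam * D ^+ 2 by rewrite mulr_ge0 ?sqr_ge0.
have lamD0 : 0 <= lam * D by rewrite mulr_ge0.
have xis2 : 0 <= (1 - xi) * s ^+ 2 by rewrite mulr_ge0// ltW.
have xis2' : 0 <= (xi - 1 / 4) * s ^+ 2 by rewrite mulr_ge0// ltW.
have inv_le : (2 - xi) * s ^+ 2 <= 1 / xi * s ^+ 2.
  by rewrite ler_wpM2r ?inv_xi_ge// ltW.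
have rsD : rho * s * D <= s ^+ 2 / 4.
  by have /= := ler_wpM2l (ltW s_gt0) rD; lra.
rewrite mulrDl in dec.
rewrite /acceptance -gE in tauD *.
rewrite mulrDl in grad_le tauD.
split; [by lra| |by lra|by lra].
move/eqP: compl; rewrite mulf_eq0 => /orP[/eqP lam_eq0|].
  by right; rewrite lam_eq0 in grad_le; lra.
rewrite subr_eq0 => /eqP DE; left.
apply: (sufficient_decrease (3 / 64)); first by lra.
have -> : - (3 / 64) * (s ^+ 3 / rho) = - (3 / 4) * (rho * s * D ^+ 2).
  by rewrite DE; field; rewrite gt_eqF.
by lra.
Qed.

End LargePenalty.

End ScalarEstimates.

(** * Acceptance of the trial steps *)

Section Acceptance.
Context {R : realType} {n : nat} (f : 'rV[R]_n -> R) (M eta xi : R).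
Hypothesis f2 : twice_differentiable f.
Hypothesis M_ge0 : 0 <= M.
Hypothesis hess_lip : forall y z : 'rV[R]_n,
  opnorm (hessian f y - hessian f z) <= M * enorm (y - z).
Hypothesis eta_range : 0 < eta < 1 / 32.
Hypothesis xi_range : 1 / 4 < xi < 1.

Let s x := Num.sqrt (enorm (grad f x)).

Lemma sqr_sqrt_grad x : s x ^+ 2 = enorm (grad f x).
Proof. by rewrite sqr_sqrtr// enorm_ge0. Qed.

Lemma powR_grad x : enorm (grad f x) `^ (3 / 2) = s x ^+ 3.
Proof.
by rewrite mulrC powRrM powR12_sqrt ?enorm_ge0// powR_mulrn// sqrtr_ge0.
Qed.

Lemma sqrt_grad_gt0 x : grad f x <> 0 -> 0 < s x.
Proof. by move=> /eqP g0; rewrite sqrtr_gt0 lt0r enorm_eq0 g0 enorm_ge0. Qed.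

Lemma tr_solution_shift x sigma r d lam : tr_solution f x sigma r d lam ->
  d *m hessian f x + (sigma * s x + lam) *: d = - grad f x.
Proof.
case=> _ _ [_ _ + _]; rewrite -addrA -raddfD/= mulmxDr mul_mx_scalar; exact.
Qed.

(** For small [rho * s] the trial step is the Newton step. *)
Lemma newton_step_accepted x m rho d lam : grad f x <> 0 ->
  (hessian f x)^T = hessian f x -> 0 < m ->
  (forall v, m * dot v v <= dot (v *m hessian f x) v) ->
  0 < rho -> 2 * (rho * s x) < m -> 4 * M * enorm (grad f x) <= m ^+ 2 ->
  tr_solution f x (atr_strategy f x rho).1 (atr_strategy f x rho).2 d lam ->
  [/\ atr_accept f eta xi x rho d lam, d *m hessian f x = - grad f x &
      enorm (grad f (x + d)) <= enorm (grad f x)].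
Proof.
move=> g0 HT m0 Hm rho0 rho_s g_small.
have s0 := sqrt_grad_gt0 _ g0.
have l_ge := lambda_min_ge _ _ _ HT (introN eqP g0) Hm.
have rs0 : 0 < rho * s x by rewrite mulr_gt0.
rewrite /atr_strategy -/(s x).
have -> : (rho * s x <= lambda_min (hessian f x)) by lra.
rewrite orbT/= => sol; have := tr_solution_shift _ _ _ _ _ sol.
case: sol => [_ _ [lam0 compl _ _]]; rewrite mul0r add0r => step.
have d_le := shifted_step_bound _ _ _ _ _ step Hm.
have lam_eq0 := small_radius_multiplier _ _ _ _ _ _ m0 rho0 s0
  (sqr_sqrt_grad x) lam0 compl d_le rho_s.
rewrite lam_eq0 addr0 in step d_le.
have Q := Hm d; rewrite -enorm_sqr in Q.
have dec := shifted_step_decrease _ _ f2 M_ge0 hess_lip _ _ _ step.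
have grad_le := shifted_step_grad _ _ f2 M_ge0 hess_lip _ _ _ step (lexx 0).
rewrite mul0r subr0 in dec; rewrite mul0r addr0 in grad_le.
have [dec0 g_xi g_invxi g_le] := newton_estimates _ _ _ _ _ _ _ _ xi_range
  m0 M_ge0 (enorm_ge0 d) (enorm_ge0 _) d_le g_small Q dec grad_le.
rewrite scale0r addr0 in step; split; [|exact: step|exact: g_le].
split; [by rewrite -subr_le0|by right|move=> _|by move=> _].
by rewrite lam_eq0 mul0r addr0.
Qed.

(** With a large penalty the radius is small enough for the quadratic model to be
    accurate, whatever the size of the gradient. *)
Lemma large_penalty_accepted x rho d lam : grad f x <> 0 ->
  psdmx (hessian f x) -> 0 < rho ->
  M <= (xi - 1 / 4) * rho ^+ 2 -> M <= (1 - xi) * rho ^+ 2 ->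
  tr_solution f x (atr_strategy f x rho).1 (atr_strategy f x rho).2 d lam ->
  atr_accept f eta xi x rho d lam.
Proof.
move=> g0 [HT H0] rho0 M1 M2.
have s0 := sqrt_grad_gt0 _ g0.
have gE := sqr_sqrt_grad x.
have Hpos v : 0 * dot v v <= dot (v *m hessian f x) v by rewrite mul0r.
have l_ge := lambda_min_ge _ _ _ HT (introN eqP g0) Hpos.
have l_le := lambda_min_le _ d HT; rewrite -enorm_sqr in l_le.
have rs0 : 0 < rho * s x by rewrite mulr_gt0.
rewrite /atr_strategy -/(s x).
have -> : (lambda_min (hessian f x) <= - (rho * s x)) = false.
  by apply/negbTE; lra.
rewrite orFb; case: ifP => l_cmp /= sol;
  have := tr_solution_shift _ _ _ _ _ sol;
  case: sol => [d_r _ [lam0 compl _ _]].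
  rewrite mul0r add0r => step.
  have lamD := shifted_step_bound _ _ _ _ _ step Hpos; rewrite add0r in lamD.
  have dec := shifted_step_decrease _ _ f2 M_ge0 hess_lip _ _ _ step.
  have grad_le := shifted_step_grad _ _ f2 M_ge0 hess_lip _ _ _ step lam0.
  have Q : rho * s x * enorm d ^+ 2 <= dot (d *m hessian f x) d.
    by apply: le_trans l_le; rewrite ler_wpM2r ?sqr_ge0.
  have [] := unregularized_estimates _ _ _ _ _ _ _ _ _ _ _ eta_range xi_range
    rho0 s0 gE M1 M2 (enorm_ge0 d) lam0 d_r compl Q lamD dec grad_le.
  by rewrite subr_le0 -(powR_grad x); split.
move=> step.
have tau0 : 0 <= rho * s x + lam by rewrite addr_ge0// ltW.
have lamD := shifted_step_bound _ _ _ _ _ step Hpos; rewrite add0r in lamD.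
have dec := shifted_step_decrease _ _ f2 M_ge0 hess_lip _ _ _ step.
have grad_le := shifted_step_grad _ _ f2 M_ge0 hess_lip _ _ _ step tau0.
have [] := regularized_estimates _ _ _ _ _ _ _ _ _ _ _ eta_range xi_range
  rho0 s0 gE M1 M2 (enorm_ge0 d) lam0 d_r compl (H0 d) lamD dec grad_le.
by rewrite subr_le0 -(powR_grad x); split.
Qed.

End Acceptance.

(** * Local convergence *)

Section LocalConvergence.
Context {R : realType} {n : nat} (f : 'rV[R]_n -> R) (M : R).
Hypothesis f2 : twice_differentiable f.
Hypothesis M_ge0 : 0 <= M.
Hypothesis hess_lip : forall y z : 'rV[R]_n,
  opnorm (hessian f y - hessian f z) <= M * enorm (y - z).

(** Applying the Hessian to the new error leaves exactly the Taylor remainder of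
    the gradient between [x] and the critical point [xs]. *)
Lemma newton_step_quadratic x xs m d : grad f xs = 0 ->
  (forall v, m * dot v v <= dot (v *m hessian f x) v) ->
  d *m hessian f x = - grad f x ->
  m * enorm (x + d - xs) <= M * enorm (x - xs) ^+ 2.
Proof.
move=> gs Hm dH; have := jacobian_taylor _ _ f2.2 M_ge0 hess_lip x (xs - x).
rewrite -/(hessian f x) (addrC x (xs - x)) subrK gs sub0r -opprD.
rewrite (enormN (_ + _)).
rewrite -(enormN (xs - x)) opprB (addrC (grad f x)).
apply: le_trans.
have step : (x + d - xs) *m hessian f x + 0 *: (x + d - xs)
    = - ((xs - x) *m hessian f x + grad f x).
  rewrite scale0r addr0 -addrA mulmxDl mulmxBl dH mulmxBl.
  move: (grad f x) (xs *m _) (x *m _) => a b c.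
  by apply/rowP => i; rewrite !mxE; ring.
by have := shifted_step_bound _ _ _ _ _ step Hm; rewrite addr0.
Qed.

Lemma hessian_lower_bound x xs mu v : psdmx (hessian f xs - mu%:M) ->
  (mu - M * enorm (x - xs)) * dot v v <= dot (v *m hessian f x) v.
Proof.
case=> _ /(_ v); rewrite mulmxBr mul_mx_scalar dotBl dotZl => Hs.
have := cauchy_schwarz (v *m (hessian f xs - hessian f x)) v.
rewrite mulmxBr dotBl -mulmxBr => cs.
have := enorm_mulmx (hessian f x - hessian f xs) v.
rewrite -(enormN (v *m _)) -mulmxN opprB => op.
have h1 := le_trans op (ler_wpM2r (enorm_ge0 v) (hess_lip x xs)).
have h2 := le_trans cs (ler_wpM2r (enorm_ge0 v) h1).
rewrite -mulrA -expr2 enorm_sqr in h2; rewrite subr_ge0 in Hs.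
by rewrite mulrBl lerBlDr; apply: le_trans Hs _; rewrite -lerBlDl.
Qed.

End LocalConvergence.

(** The penalty argument, for abstract sequences [p] of penalties and [s] of
    square roots of gradient norms.  If [p k * s k >= c] held for all large [k],
    then [p k >= rhobar] eventually, the penalties would be bounded, and
    [p k * s k] would tend to 0; so [p k * s k < c] at some late index, and from
    there on it is inherited. *)
Lemma penalty_times_root_gradient_small (R : realType) (p s : nat -> R)
    (c rhomin rhobar : R) (K : nat) :
  0 < c -> (forall k, 0 < p k) -> (forall k, 0 <= s k) ->
  s k @[k --> \oo] --> (0 : R) ->
  (forall k, (K <= k)%N -> p k * s k < c ->
     p k.+1 <= Num.max rhomin (p k) /\ s k.+1 <= s k) ->
  (forall k, (K <= k)%N -> rhobar <= p k -> p k.+1 <= Num.max rhomin (p k)) ->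
  exists K', forall k, (K' <= k)%N -> p k * s k < c.
Proof.
move=> c0 p0 s0 s_cvg small large.
have s_small a : exists N, forall k, (N <= k)%N -> a * s k < c.
  have as_cvg : a * s k @[k --> \oo] --> (a * 0 : R).
    by apply: cvgM s_cvg; exact: cvg_cst.
  rewrite mulr0 in as_cvg; have [N _ NP] := cvgr_lt _ as_cvg _ c0.
  by exists N => k Nk; exact: NP.
have [N1 N1P] := s_small rhomin; have [N2 N2P] := s_small rhobar.
pose K1 := maxn K (maxn N1 N2).
have [k0 K1k0 k0P] : exists2 k, (K1 <= k)%N & p k * s k < c.
  apply: contrapT => no.
  have big k : (K1 <= k)%N -> c <= p k * s k.
    by move=> K1k; rewrite leNgt; apply/negP => lt; apply: no; exists k.
  pose b := Num.max rhomin (p K1).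
  have p_le j : p (K1 + j)%N <= b.
    elim: j => [|j IH]; first by rewrite addn0 le_max lexx orbT.
    have K1j : (K1 <= K1 + j)%N by rewrite leq_addr.
    rewrite addnS; apply: le_trans (large _ _ _) _.
    - by apply: leq_trans K1j; rewrite leq_maxl.
    - rewrite leNgt; apply/negP => lt; have := big _ K1j; rewrite leNgt.
      move=> /negP; apply; apply: le_lt_trans (N2P (K1 + j)%N _).
        by rewrite ler_wpM2r// ltW.
      by apply: leq_trans K1j; rewrite !leq_max leqnn !orbT.
    - by rewrite ge_max IH le_max lexx.
  have [N3 N3P] := s_small b.
  have := big (K1 + N3)%N (leq_addr _ _); rewrite leNgt => /negP; apply.
  apply: le_lt_trans (N3P _ (leq_addl _ _)); exact: ler_wpM2r.
exists k0 => k /subnKC <-; elim: (k - k0)%N => [|j IH]; first by rewrite addn0.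
have K1k : (K1 <= k0 + j)%N by rewrite (leq_trans K1k0)// leq_addr.
have Kk : (K <= k0 + j)%N by apply: leq_trans K1k; rewrite leq_maxl.
have [p_le s_le] := small _ Kk IH; rewrite addnS.
apply: le_lt_trans (ler_wpM2r (s0 _) p_le) _.
rewrite maxr_pMl// gt_max N1P/=; last first.
  by rewrite (leq_trans _ (leqW K1k))// !leq_max leqnn orbT.
by apply: le_lt_trans IH; rewrite ler_wpM2l// ltW.
Qed.

Theorem theorem4p3 (R : realType) (n : nat) (f : 'rV[R]_n -> R) (M : R)
    (eta xi rho0 rhomin gamma1 gamma2 : R)
    (x0 : 'rV[R]_n) (x : nat -> 'rV[R]_n) (xs : 'rV[R]_n) (mu : R)
    (f_twice_diff : twice_differentiable f)
    (f_bounded_below : has_lbound (range f))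
    (M_gt0 : 0 < M)
    (hessian_lipschitz : forall y z : 'rV[R]_n,
      opnorm (hessian f y - hessian f z) <= M * enorm (y - z))
    (eta_range : 0 < eta < 1 / 32)
    (xi_range : 1 / 4 < xi < 1)
    (rho0_gt0 : 0 < rho0)
    (rhomin_gt0 : 0 < rhomin)
    (gamma1_gt1 : 1 < gamma1)
    (gamma2_gt1 : 1 < gamma2)
    (x_iterates : atr_iterates f eta xi rho0 rhomin gamma1 gamma2 x0 x)
    (x_cvg : x k @[k --> \oo] --> xs)
    (grad_xs : grad f xs = 0)
    (mu_gt0 : 0 < mu)
    (hessian_xs : psdmx (hessian f xs - mu%:M)) :
  exists2 C : R, 0 < C &
    \forall k \near \oo, enorm (x k.+1 - xs) <= C * enorm (x k - xs) ^+ 2.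
Proof.
have [J [rho [d [lam [_ rho00 step]]]]] := x_iterates.
pose m := mu / 2; have m_gt0 : 0 < m by rewrite divr_gt0.
have M_ge0 := ltW M_gt0.
have /andP[xi0 xi1] := xi_range.
pose s y := Num.sqrt (enorm (grad f y)).
have rho_gt0 k : 0 < rho k 0%N.
  case: k => [|k]; first by rewrite rho00.
  by have [_ _ _ _ [_ ->]] := step k; rewrite lt_max rhomin_gt0.
have first_accepted k :
    atr_accept f eta xi (x k) (rho k 0%N) (d k 0%N) (lam k 0%N) -> J k = 0%N.
  move=> acc; have [_ _ rej _ _] := step k.
  by case: (J k) rej => // j /(_ 0%N isT)[].
have x_dist : enorm (x k - xs) @[k --> \oo] --> (0 : R).
  rewrite -(@enorm0 R n) -(subrr xs).
  apply: (cvg_comp _ _ (cvgB x_cvg (cvg_cst xs))); exact: enorm_continuous.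
have s_cvg : s (x k) @[k --> \oo] --> (0 : R).
  have <- : s xs = 0 by rewrite /s grad_xs enorm0 sqrtr0.
  apply: continuous_cvg x_cvg.
  apply: continuous_comp; last exact: sqrt_continuous.
  apply: continuous_comp; last exact: enorm_continuous.
  exact: differentiable_continuous (f_twice_diff.2 xs).
have sE k : s (x k) ^+ 2 = enorm (grad f (x k)) by exact: sqr_sqrt_grad.
have solution k : tr_solution f (x k) (atr_strategy f (x k) (rho k 0%N)).1
    (atr_strategy f (x k) (rho k 0%N)).2 (d k 0%N) (lam k 0%N).
  by have [_ sol _ _ _] := step k; exact: sol.
(* The symmetry of the Hessian at the iterates is part of the optimality
   conditions of the subproblem. *)
have hess_sym k : (hessian f (x k))^T = hessian f (x k).
  have [_ _ [_ _ _ [+ _]]] := solution k.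
  by rewrite !linearD/= !tr_scalar_mx => /addIr/addIr.
have grad_neq0 k : grad f (x k) <> 0 by have [] := step k.
have next_penalty k : J k = 0%N ->
    rho k.+1 0%N <= Num.max rhomin (rho k 0%N).
  move=> Jk; have [_ _ _ _ [_ ->]] := step k; rewrite Jk.
  rewrite ge_max !le_max lexx/=; apply/orP; right.
  by rewrite ler_pdivrMr ?(lt_trans ltr01)// ler_peMr ?ltW.
have [K KP] : exists K, forall k, (K <= k)%N ->
    (forall v, m * dot v v <= dot (v *m hessian f (x k)) v) /\
    4 * M * enorm (grad f (x k)) <= m ^+ 2.
  have m_M : 0 < m / M by rewrite divr_gt0.
  have [N1 _ N1P] := cvgr_lt _ x_dist _ m_M.
  have g_bound : 0 < m / (2 * (1 + M)) by rewrite divr_gt0// mulr_gt0//; lra.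
  have [N2 _ N2P] := cvgr_lt _ s_cvg _ g_bound.
  exists (maxn N1 N2) => k; rewrite geq_max => /andP[/N1P/= xk /N2P/= sk].
  split.
    move=> v; apply: le_trans
      (hessian_lower_bound _ _ hessian_lipschitz _ xs mu v hessian_xs).
    rewrite ler_wpM2r ?dot_ge0//; rewrite ltr_pdivlMr// mulrC in xk.
    by rewrite lerBrDl; move: (ltW xk) => xk'; rewrite /m in xk' *; lra.
  rewrite -(sE k).
  have s0 : 0 <= s (x k) by exact: sqrtr_ge0.
  rewrite ltr_pdivlMr in sk; last by lra.
  move: (s (x k)) sk s0 => t tm t0.
  apply: le_trans (_ : (t * (2 * (1 + M))) ^+ 2 <= _); last first.
    by rewrite lerXn2r ?nnegrE ?(ltW m_gt0) ?(ltW tm)// mulr_ge0//; lra.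
  rewrite exprMn mulrC ler_wpM2l ?sqr_ge0//; have := sqr_ge0 M; nra.
have newton k : (K <= k)%N -> rho k 0%N * s (x k) < m / 2 ->
    [/\ J k = 0%N, d k 0%N *m hessian f (x k) = - grad f (x k) &
        enorm (grad f (x k.+1)) <= enorm (grad f (x k))].
  move=> Kk rs; have [Hm g_small] := KP k Kk.
  have rs' : 2 * (rho k 0%N * s (x k)) < m by lra.
  have [acc dH g_le] := newton_step_accepted _ _ eta _ f_twice_diff M_ge0
    hessian_lipschitz xi_range _ _ _ _ _ (grad_neq0 k) (hess_sym k) m_gt0 Hm
    (rho_gt0 k) rs' g_small (solution k).
  have Jk := first_accepted k acc.
  by have [_ _ _ _ [-> _]] := step k; rewrite Jk.
(* [rho >= 1 + M / a] gives [M <= a * rho <= a * rho ^+ 2]. *)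
pose rhobar := 1 + M / (xi - 1 / 4) + M / (1 - xi).
have rhobar_large k : rhobar <= rho k 0%N ->
    M <= (xi - 1 / 4) * rho k 0%N ^+ 2 /\ M <= (1 - xi) * rho k 0%N ^+ 2.
  have bound a : 0 < a -> 1 + M / a <= rho k 0%N -> M <= a * rho k 0%N ^+ 2.
    move=> a0; move: (rho k 0%N) => r ar.
    have Ma : 0 <= M / a by rewrite divr_ge0// ltW.
    rewrite -ler_pdivrMl// mulrC; apply: le_trans (_ : r <= _); first by lra.
    by rewrite ler_eXnr//; lra.
  have [a0 b0] : 0 < xi - 1 / 4 /\ 0 < 1 - xi by split; lra.
  have [Ma Mb] : 0 <= M / (xi - 1 / 4) /\ 0 <= M / (1 - xi).
    by split; rewrite divr_ge0// ltW.
  by rewrite /rhobar => big; split; apply: bound => //; lra.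
have hess_psd k : (K <= k)%N -> psdmx (hessian f (x k)).
  move=> Kk; split; first exact: hess_sym.
  have [Hm _] := KP k Kk; move=> v; apply: le_trans (Hm v).
  by rewrite mulr_ge0 ?dot_ge0// ltW.
have m2_gt0 : 0 < m / 2 by rewrite divr_gt0.
have s_ge0 k : 0 <= s (x k) by exact: sqrtr_ge0.
have small_case k : (K <= k)%N -> rho k 0%N * s (x k) < m / 2 ->
    rho k.+1 0%N <= Num.max rhomin (rho k 0%N) /\ s (x k.+1) <= s (x k).
  move=> Kk rs; have [Jk _ g_le] := newton k Kk rs.
  by split; [exact: next_penalty|exact: ler_wsqrtr].
have large_case k : (K <= k)%N -> rhobar <= rho k 0%N ->
    rho k.+1 0%N <= Num.max rhomin (rho k 0%N).
  move=> Kk /rhobar_large[M1 M2]; apply: next_penalty; apply: first_accepted.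
  exact: (large_penalty_accepted _ _ _ _ f_twice_diff M_ge0 hessian_lipschitz
    eta_range xi_range _ _ _ _ (grad_neq0 k) (hess_psd k Kk) (rho_gt0 k) M1 M2
    (solution k)).
have [K' K'P] := @penalty_times_root_gradient_small R (fun k => rho k 0%N)
  (fun k => s (x k)) _ _ _ _ m2_gt0 rho_gt0 s_ge0 s_cvg small_case large_case.
(* From index [maxn K K'] on every step is a Newton step. *)
exists (M / m); first by rewrite divr_gt0.
exists (maxn K K') => // k /=; rewrite geq_max => /andP[Kk K'k].
have [Jk dH _] := newton k Kk (K'P k K'k).
have [Hm _] := KP k Kk.
have [_ _ _ _ [-> _]] := step k; rewrite Jk.
rewrite mulrAC ler_pdivlMr// mulrC.
exact: (newton_step_quadratic _ _ f_twice_diff M_ge0 hessian_lipschitz).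
Qed.
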